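(* Let $\alpha,\beta,\gamma,\delta$ be positive real numbers with $\beta>2\gamma+3\alpha$, $\gamma>2\alpha$ and $\delta\ge1$. Define $A:[0,\infty)\to\mathbb R^{2\times2}$ by $$A(t)=\begin{pmatrix}-\alpha&\delta\\0&-\beta\end{pmatrix}\ \text{ if } t\in[0,1)\text{ or } 2^{2k+1}\le t<2^{2k+2}\text{ for some }k\in\mathbb N_0,$$ $$A(t)=\begin{pmatrix}-\alpha&\delta\\0&\gamma\end{pmatrix}\ \text{ if } 2^{2k}\le t<2^{2k+1}\text{ for some }k\in\mathbb N_0 .$$ Then the Bohl spectrum of $\dot x=A(t)x$ satisfies $\Sigma_{\rm Bohl}\le-\alpha<0$, i.e. every $\lambda\in\Sigma_{\rm Bohl}$ satisfies $\lambda\le-\alpha$.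
   Context: Let $X(t)$ be the fundamental matrix of $\dot x=A(t)x$ with $X(0)$ the identity, and $\overline{\mathbb R}=\mathbb R\cup\{-\infty,\infty\}$. For $\xi\neq0$, the Bohl spectrum $\Sigma_\xi$ of the solution $X(\cdot)\xi$ is the set of all $\lambda\in\overline{\mathbb R}$ for which there are sequences $t_n,s_n\in[0,\infty)$ with $t_n-s_n\to\infty$ and $\lim_{n\to\infty}\frac1{t_n-s_n}\ln\frac{\|X(t_n)\xi\|}{\|X(s_n)\xi\|}=\lambda$. The Bohl spectrum of the equation is $\Sigma_{\rm Bohl}=\bigcup_{\xi\neq0}\Sigma_\xi$. *)

(* Defs.v *)
From HB Require Import structures.
From mathcomp Require Import all_boot all_order all_algebra.
From mathcomp Require Import all_classical all_reals all_analysis.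

Set Implicit Arguments.
Unset Strict Implicit.
Unset Printing Implicit Defensive.

Import Order.TTheory GRing.Theory Num.Theory.
Import numFieldNormedType.Exports.

Local Open Scope classical_set_scope.
Local Open Scope ring_scope.

(* The norm on the state space is left arbitrary; the library's canonical norm
   on column vectors (the maximum norm) is one instance. *)
Definition is_norm (R : realType) (d : nat) (N : 'cV[R]_d -> R) : Prop :=
  [/\ forall x y, N (x + y) <= N x + N y,
      forall (a : R) x, N (a *: x) = `|a| * N x
    & forall x, N x = 0 -> x = 0].

(* A may be discontinuous, so solutions are understood in the sense of
   Caratheodory, i.e. through the integrated equation. The integrability clause
   is needed because the integral of a non-integrable function is a junk value.
   Only the values of A and X on [0, +oo[ matter. *)
Definition fundamental_matrix (R : realType) (d : nat)
    (A X : R -> 'M[R]_d) : Prop :=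
  X 0 = 1%:M /\
  forall (t : R) (i j : 'I_d), 0 <= t ->
    lebesgue_measure.-integrable `[0, t]
      (fun s : R => ((A s *m X s) i j)%:E) /\
    X t i j =
      X 0 i j + \int[lebesgue_measure]_(s in `[0, t]) (A s *m X s) i j.

Definition bohl_spectrum_solution (R : realType) (d : nat)
    (N : 'cV[R]_d -> R) (X : R -> 'M[R]_d) (xi : 'cV[R]_d) : set (\bar R) :=
  [set l | exists t s : nat -> R,
    [/\ forall n, 0 <= t n, forall n, 0 <= s n,
        t n - s n @[n --> \oo] --> +oo
      & ((t n - s n)^-1
          * ln (N (X (t n) *m xi) / N (X (s n) *m xi)))%:E @[n --> \oo]
          --> l]].

Definition bohl_spectrum (R : realType) (d : nat)
    (N : 'cV[R]_d -> R) (X : R -> 'M[R]_d) : set (\bar R) :=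
  \bigcup_(xi in [set xi : 'cV[R]_d | xi != 0])
    bohl_spectrum_solution N X xi.

Definition upper_triangular (R : realType) (a b c : R) : 'M[R]_2 :=
  \matrix_(i < 2, j < 2)
    nth 0 (nth [::] [:: [:: a; b]; [:: 0; c]] i) j.

Definition growth_phase (R : realType) (t : R) : Prop :=
  exists k : nat, 2 ^+ (2 * k) <= t < 2 ^+ (2 * k + 1).

Definition decay_phase (R : realType) (t : R) : Prop :=
  0 <= t < 1 \/ exists k : nat, 2 ^+ (2 * k + 1) <= t < 2 ^+ (2 * k + 2).

Definition switched_matrix (R : realType) (alpha beta gamma delta t : R) :
    'M[R]_2 :=
  if `[< growth_phase t >] then upper_triangular (- alpha) delta gamma
  else upper_triangular (- alpha) delta (- beta).

Lemma switched_matrix_growth (R : realType) (alpha beta gamma delta t : R) :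
  growth_phase t ->
  switched_matrix alpha beta gamma delta t =
  upper_triangular (- alpha) delta gamma.
Proof. by rewrite /switched_matrix => /asboolP ->. Qed.

Lemma switched_matrix_decay (R : realType) (alpha beta gamma delta t : R) :
  decay_phase t ->
  switched_matrix alpha beta gamma delta t =
  upper_triangular (- alpha) delta (- beta).
Proof.
move=> dt; rewrite /switched_matrix; case: asboolP => // -[k /andP[kt tk]].
have two1 : 1 < 2 :> R by rewrite ltr1n.
case: dt => [/andP[_ t1]|[j /andP[jt tj]]].
  by have := lt_le_trans t1 (exprn_ege1 (2 * k) (ltW two1)); rewrite ltNge kt.
have := le_lt_trans kt tj; have := le_lt_trans jt tk.
rewrite !ltr_eXn2l // !mul2n !addn1 addn2 -doubleS ltnS !ltn_double ltnS.
by move=> jk; rewrite leqNgt jk.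
Qed.

(* On [0, +oo[ exactly one of the two phases holds at each time. *)
Lemma growth_or_decay_phase (R : realType) (t : R) :
  0 <= t -> growth_phase t \/ decay_phase t.
Proof.
move=> t0; have [t1|t1] := ltP t 1; first by right; left; rewrite t0 t1.
have two1 : 1 < 2 :> R by rewrite ltr1n.
have ub : exists n : nat, t < 2 ^+ n.
  exists (Num.bound t); apply: (lt_le_trans (archi_boundP t0)).
  by rewrite -natrX ler_nat ltnW // ltn_expl.
case: (ex_minnP ub) => -[|n]; first by rewrite expr0 ltNge t1.
move=> tn min_n; have nt : 2 ^+ n <= t.
  by rewrite leNgt; apply/negP => /min_n; rewrite ltnn.
have := odd_double_half n; case: (odd n) => /= nE.
  right; right; exists n./2.
  by rewrite add1n in nE; rewrite mul2n addn1 addn2 nE nt.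
by left; exists n./2; rewrite mul2n addn1; rewrite add0n in nE; rewrite nE nt.
Qed.

(* Main.v *)
Require Import Defs.
From HB Require Import structures.
From mathcomp Require Import all_boot all_order all_algebra.
From mathcomp Require Import all_classical all_reals all_analysis.
From mathcomp Require Import ring lra.

(** Let (p, q) be a solution and w = e^(alpha t) (p, q), so that w1' = delta w2 and
    w2' = (c + alpha) w2, where c is gamma in the growth phases and - beta in the
    decay phases. It suffices to find, for each solution, a constant C such that
    |w(t)| <= C |w(s)| whenever 0 <= s <= t: then
    ln (|x(t)| / |x(s)|) <= - alpha (t - s) + ln C, and dividing by t - s -> +oo
    bounds every element of the spectrum by - alpha. The constant may depend on the
    solution, because the Bohl spectrum is taken solution by solution; it is not
    uniform over solutions. The estimate passes from one norm to any other,
    since all norms on the plane are equivalent ([is_norm_le], [is_norm_ge]).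

    If q(0) = 0 then w is constant ([trajectory_invariant_line]). Otherwise let
    q(0) > 0, up to the sign of the solution. A growth phase lasts at most twice as
    long as the decay phase before it, so q decays on average at rate at least
    theta = (beta - 2 gamma) / 3 > alpha ([trajectory_snd_exponent]): w2 decays
    exponentially and w1, whose derivative is delta w2, is increasing and bounded.
    As w2 itself cannot decay faster than e^(- (beta - alpha) t), the function
    w1 + kappa w2 with kappa = delta / (beta - alpha) is nondecreasing too. Two cases
    remain ([scaled_trajectory_estimate]).
    - If w1 + kappa w2 is positive somewhere, it stays away from 0 from then on, and
      |w| lies between two positive constants.
    - If w1 + kappa w2 <= 0 throughout, then w2 <= |w1| / kappa, so |w| is comparable
      to |w1|, and |w1| = - w1 is nonincreasing. The solutions with w -> 0
      are of this kind: for them - w1(t) is the integral of delta w2 over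
      [t, +oo[, hence large before a growth phase of w2. *)

Set Implicit Arguments.
Unset Strict Implicit.
Unset Printing Implicit Defensive.

Import Order.TTheory GRing.Theory Num.Theory.
Import numFieldNormedType.Exports.

Local Open Scope classical_set_scope.
Local Open Scope ring_scope.

(** * The integrated equation *)

(** The Caratheodory form of u' = g on [0, +oo[. *)
Definition is_primitive (R : realType) (u g : R -> R) : Prop :=
  forall t, 0 <= t ->
    lebesgue_measure.-integrable `[0, t] (EFin \o g) /\
    u t = u 0 + \int[lebesgue_measure]_(s in `[0, t]) g s.

Lemma is_primitive0 (R : realType) :
  is_primitive (fun=> 0 : R) (fun=> 0 : R).
Proof.
move=> t t0; split; first exact: integrable0.
by rewrite Rintegral_cst ?mul0r ?addr0 //; exact: measurable_itv.
Qed.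

Lemma is_primitiveD (R : realType) (u v g h : R -> R) :
  is_primitive u g -> is_primitive v h ->
  is_primitive (fun t => u t + v t) (fun t => g t + h t).
Proof.
move=> ug vh t t0; have [ig ->] := ug t t0; have [ih ->] := vh t t0; split.
  have -> : EFin \o (fun s => g s + h s) = (EFin \o g) \+ (EFin \o h).
    by apply/funext => s; rewrite /= EFinD.
  by apply: integrableD => //; exact: measurable_itv.
by rewrite RintegralD //; ring.
Qed.

Lemma is_primitiveZ (R : realType) (k : R) (u g : R -> R) :
  is_primitive u g -> is_primitive (fun t => u t * k) (fun t => g t * k).
Proof.
move=> ug t t0; have [ig ->] := ug t t0; split.
  have -> : EFin \o (fun s => g s * k) = (fun s => k%:E * (EFin \o g) s)%E.
    by apply/funext => s; rewrite /= -EFinM mulrC.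
  by apply: integrableZl => //; exact: measurable_itv.
by rewrite RintegralZr ?mulrDl //; exact: measurable_itv.
Qed.

Lemma is_primitive_sum (R : realType) (I : Type) (r : seq I) (u g : I -> R -> R) :
  (forall i, is_primitive (u i) (g i)) ->
  is_primitive (fun t => \sum_(i <- r) u i t) (fun t => \sum_(i <- r) g i t).
Proof.
move=> ug; elim: r => [|i r IH].
  have sum_nil (f : I -> R -> R) : (fun t => \sum_(i <- [::]) f i t) = fun=> 0.
    by apply/funext => t; rewrite big_nil.
  by rewrite (sum_nil u) (sum_nil g); exact: is_primitive0.
have sum_cons (f : I -> R -> R) : (fun t => \sum_(j <- i :: r) f j t) =
    fun t => f i t + \sum_(j <- r) f j t.
  by apply/funext => t; rewrite big_cons.
by rewrite (sum_cons u) (sum_cons g); exact: is_primitiveD.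
Qed.

Lemma is_primitive_continuous (R : realType) (u g : R -> R) (b : R) :
  is_primitive u g -> 0 <= b -> {within `[0, b], continuous u}.
Proof.
move=> ug b0.
have [ig _] := ug b b0.
have ci := parameterized_integral_continuous b0 ig.
apply: (@subspace_eq_continuous _ _ _
  (fun x => u 0 + parameterized_integral lebesgue_measure 0 x g)).
  move=> x; rewrite inE /= in_itv /= => /andP[x0 _].
  by have [_ ux] := ug x x0; exact: esym ux.
by move=> x; apply: cvgD; [exact: cvg_cst|exact: ci].
Qed.

Lemma is_primitive_continuous_at (R : realType) (u g : R -> R) (t : R) :
  is_primitive u g -> 0 < t -> {for t, continuous u}.
Proof.
move=> ug t0.
apply: (@within_continuous_continuous R R _ 0 (t + 1)); first lra.
  by apply: is_primitive_continuous ug _; lra.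
by rewrite in_itv /=; lra.
Qed.

Lemma is_primitive_derive (R : realType) (u g : R -> R) (t : R) :
  is_primitive u g -> 0 < t -> {for t, continuous g} -> is_derive t 1 u (g t).
Proof.
move=> ug t0 cg.
have [ig _] := ug (t + 1) ltac:(lra).
have [dF F'] := @continuous_FTC1_closed R g 0 t (t + 1) ltac:(lra) ig t0 cg.
have dG : is_derive t 1
    (fun y => u 0 + \int[lebesgue_measure]_(s in `[0, y]) g s) (g t).
  rewrite -[g t]add0r -F' derive1E.
  exact: (is_deriveD (is_derive_cst _ _ _) (derivableP dF)).
apply: near_eq_is_derive dG.
near=> y; have y0 : 0 <= y by apply: ltW; near: y; exact: lt_nbhsr.
by have [_ ->] := ug y y0.
Unshelve. all: by end_near. Qed.

(** The right-hand side g may be a discontinuous expression that coincides near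
    t with a continuous h, as happens inside a phase of the switching. *)
Lemma is_primitive_derive_near (R : realType) (u g h : R -> R) (t : R) :
  is_primitive u g -> 0 < t -> (\forall s \near t, g s = h s) ->
  {for t, continuous h} -> is_derive t 1 u (h t).
Proof.
move=> ug t0 gh ch; have ght := nbhs_singleton gh.
rewrite -ght; apply: is_primitive_derive => //.
rewrite /continuous_at /prop_for ght.
apply: cvg_trans ch; apply: near_eq_cvg.
by apply: filterS gh => s ->.
Qed.

(** * Norms on column vectors *)

Lemma is_norm_ge0 (R : realType) (d : nat) (N : 'cV[R]_d -> R) :
  is_norm N -> forall x, 0 <= N x.
Proof.
case=> ND NZ _ x.
have N0 : N 0 = 0 by rewrite -(scale0r 0) NZ normr0 mul0r.
have := ND x (-1 *: x).
by rewrite NZ normrN1 mul1r scaleN1r subrr N0; lra.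
Qed.

Lemma is_normN (R : realType) (d : nat) (N : 'cV[R]_d -> R) :
  is_norm N -> forall x, N (- x) = N x.
Proof. by case=> _ NZ _ x; rewrite -scaleN1r NZ normrN1 mul1r. Qed.

Lemma is_norm_sum (R : realType) (d : nat) (N : 'cV[R]_d -> R) (I : finType)
    (F : I -> 'cV[R]_d) :
  is_norm N -> N (\sum_i F i) <= \sum_i N (F i).
Proof.
case=> ND NZ _; elim/big_ind2 : _ => // [|x a y b xa yb].
  by rewrite -(scale0r 0) NZ normr0 mul0r.
by apply: le_trans (ND _ _) _; exact: lerD.
Qed.

Lemma ler_coord_norm (R : realType) (d : nat) (x : 'cV[R]_d) (i : 'I_d) :
  `|x i 0| <= `|x|.
Proof.
rewrite [leRHS]mx_normrE; exact: (le_bigmax _ (fun k => `|x k.1 k.2|) (i, 0)).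
Qed.

Lemma is_norm_le (R : realType) (d : nat) (N : 'cV[R]_d -> R) :
  is_norm N -> exists2 M, 0 < M & forall x, N x <= M * `|x|.
Proof.
move=> NN; have NZ := let: And3 _ h _ := NN in h.
exists (1 + \sum_i N (delta_mx i 0)).
  by apply: ltr_wpDr => //; apply: sumr_ge0 => i _; exact: is_norm_ge0.
move=> x; apply: (@le_trans _ _ ((\sum_i N (delta_mx i 0)) * `|x|)); last first.
  by apply: ler_wpM2r => //; rewrite lerDr.
rewrite {1}[x]matrix_sum_delta.
apply: le_trans (is_norm_sum _ NN) _.
rewrite mulr_suml; apply: ler_sum => i _.
rewrite big_ord_recl big_ord0 addr0 NZ mulrC.
by apply: ler_wpM2l; [exact: is_norm_ge0|exact: ler_coord_norm].
Qed.

(** Compactness of the unit sphere: N is continuous and positive there, so it has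
    a positive minimum, and homogeneity does the rest. *)
Lemma is_norm_ge (R : realType) (d : nat) (N : 'cV[R]_d -> R) :
  is_norm N -> exists2 m, 0 < m & forall x, m * `|x| <= N x.
Proof.
move=> NN; have [ND NZ N0] := NN; have [M M0 NM] := is_norm_le NN.
(* [bounded_closed_compact] concerns row vectors. *)
pose P (v : 'rV[R]_d) := N v^T.
have normT (v : 'rV[R]_d) : `|v^T| = `|v|.
  rewrite [LHS]mx_normrE [RHS]mx_normrE.
  rewrite (reindex (fun k : 'I_1 * 'I_d => (k.2, k.1))) /=; last first.
    by exists (fun k => (k.2, k.1)) => -[].
  by apply: eq_bigr => -[i j] _ /=; rewrite mxE.
have Pc : continuous P.
  move=> v; apply/(@cvgrPdist_le _ _ _ _ (nbhs_filter v)) => e e0; near=> w.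
  have lip a b : P a - P b <= M * `|a - b|.
    rewrite lerBlDr -normT; apply: le_trans (lerD (NM _) (lexx _)).
    by apply: le_trans (ND _ _); rewrite linearB /= subrK.
  have vw : M * `|v - w| <= e.
    rewrite mulrC -ler_pdivlMr //; near: w.
    apply/(@nbhs_normP R 'rV[R]_d); exists (e / M); first exact: divr_gt0.
    by move=> z /= /ltW.
  rewrite ler_norml; have := lip v w; have := lip w v.
  by rewrite (distrC w v); lra.
pose S := [set v : 'rV[R]_d | `|v| = 1].
have Sc : compact S.
  apply: bounded_closed_compact.
    by exists 1; split=> // x x1 v /= ->; exact: ltW.
  apply: (@closed_comp _ _ (fun v : 'rV[R]_d => `|v|) [set 1]).
    by move=> v _; exact: norm_continuous.
  by apply: compact_closed => //; exact: compact_set1.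
(* The sphere is empty when d = 0. *)
have [S0|/set0P S0] := eqVneq S set0.
  exists 1 => // x; have [->|x0] := eqVneq x 0.
    by rewrite normr0 mulr0; exact: is_norm_ge0.
  suff : S (`|x|^-1 *: x^T) by rewrite S0.
  by rewrite /S /= normrZ normfV normr_id -normT trmxK mulVf ?normr_eq0.
have [v Sv minv] := compact_EVT_min S0 Sc (continuous_subspaceT Pc).
exists (P v).
  rewrite lt_neqAle is_norm_ge0 // andbT eq_sym; apply/eqP => /N0 vT0.
  move: Sv; rewrite inE /S /= -normT vT0 normr0 => /eqP.
  by rewrite eq_sym oner_eq0.
move=> x; have [->|x0] := eqVneq x 0.
  by rewrite normr0 mulr0; exact: is_norm_ge0.
have nx : 0 < `|x| by rewrite normr_gt0.
rewrite -ler_pdivlMr // mulrC.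
have := minv (`|x|^-1 *: x^T).
rewrite /P linearZ /= trmxK NZ normfV normr_id; apply.
rewrite inE /S /= normrZ normfV normr_id -normT trmxK mulVf //.
by rewrite gt_eqF.
Unshelve. all: by end_near. Qed.

(** * Phases of the switching *)

(** The endpoints 0, 1, 2, 4, 8, ... of the phases; the phase that starts at
    switch_time n is a decay phase for n even and a growth phase for n odd. *)
Definition switch_time (R : realType) (n : nat) : R :=
  if n is m.+1 then 2 ^+ m else 0.

Definition switch_rate (R : realType) (beta gamma : R) (n : nat) : R :=
  if odd n then gamma else - beta.

Lemma switch_timeS (R : realType) (n : nat) :
  switch_time R n < switch_time R n.+1.
Proof.
case: n => [|n] /=; first by rewrite expr0.
by rewrite ltr_eXn2l ?ltr1n.
Qed.

Lemma switch_time_ge0 (R : realType) (n : nat) : 0 <= switch_time R n.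
Proof. by case: n => // n; exact: exprn_ge0. Qed.

Lemma switch_time_bound (R : realType) (t : R) :
  exists n, t <= switch_time R n.
Proof.
have [t0|t0] := leP t 0; first by exists 0%N.
exists (Num.bound t).+1; apply: ltW; apply: (lt_trans (archi_boundP (ltW t0))).
by rewrite /= -natrX ltr_nat ltn_expl.
Qed.

(** Beyond the initial pair [0, 1[, [1, 2[, the two phases are [T, 2 T[ and
    [2 T, 4 T[, which gives equality. *)
Lemma switch_time_double_gap (R : realType) (m : nat) :
  switch_time R m.*2.+2 - switch_time R m.*2.+1 <=
  2 * (switch_time R m.*2.+1 - switch_time R m.*2).
Proof.
case: m => [|m]; first by rewrite /= expr0 expr1; lra.
rewrite doubleS /= !exprS; have : 0 <= 2 ^+ m.*2 :> R by exact: exprn_ge0.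
by lra.
Qed.

Lemma switched_matrix_piece (R : realType) (alpha beta gamma delta t : R) n :
  switch_time R n <= t < switch_time R n.+1 ->
  switched_matrix alpha beta gamma delta t =
  upper_triangular (- alpha) delta (switch_rate beta gamma n).
Proof.
move=> nt; rewrite /switch_rate; case: n nt => [|n] /= nt.
  by rewrite switched_matrix_decay //; left; rewrite expr0 in nt.
have := odd_double_half n; case: (odd n) => /= nE.
  rewrite switched_matrix_decay //; right; exists n./2.
  by rewrite add1n in nE; rewrite mul2n addn1 addn2 nE.
rewrite switched_matrix_growth //; exists n./2.
by rewrite add0n in nE; rewrite mul2n addn1 nE.
Qed.

(** The mean value theorem on each phase, glued by induction on the number of
    phases, which allows corners at the switching times. *)
Lemma piecewise_nondecreasing (R : realType) (f df : R -> R) :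
  (forall b, 0 <= b -> {within `[0, b], continuous f}) ->
  (forall n t, switch_time R n < t < switch_time R n.+1 ->
     is_derive t 1 f (df t) /\ 0 <= df t) ->
  forall s t, 0 <= s -> s <= t -> f s <= f t.
Proof.
move=> cf f' s t s0 st.
have piece n x y : switch_time R n <= x -> x <= y ->
    y <= switch_time R n.+1 -> f x <= f y.
  move=> nx xy yn; rewrite -subr_ge0.
  have xyn z : z \in `]x, y[%R -> switch_time R n < z < switch_time R n.+1.
    rewrite in_itv => /andP[xz zy].
    by rewrite (le_lt_trans nx xz) (lt_le_trans zy yn).
  have cxy : {within `[x, y], continuous f}.
    have x0 := le_trans (switch_time_ge0 R n) nx.
    apply: continuous_subspaceW (cf y (le_trans x0 xy)).
    by apply: subset_itvr; rewrite bnd_simp.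
  move: xy; rewrite le_eqVlt => /predU1P[->|xy]; first by rewrite subrr.
  have [c cxyI ->] := MVT xy (fun z zI => (f' n z (xyn z zI)).1) cxy.
  by rewrite mulr_ge0 ?subr_ge0 ?(ltW xy) // (f' n c (xyn c cxyI)).2.
have [n tn] := switch_time_bound t.
elim: n s t s0 st tn => [|n IH] s t s0 st tn.
  by move: tn => /= tn; rewrite (_ : s = t) //; lra.
have [tn'|nt] := leP t (switch_time R n); first exact: IH.
have [ns|sn] := leP (switch_time R n) s; first exact: (piece n).
apply: (@le_trans _ _ (f (switch_time R n))); first by apply: IH => //; exact: ltW.
by apply: (piece n) => //; exact: ltW.
Qed.

(** * Trajectories of the switched system *)

(** Multiplying by e^(kt) shifts the growth rate by k; this is how the factor
    e^(- alpha t) is removed from the solutions. *)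
Lemma is_derive_expRM (R : realType) (k t df : R) (f : R -> R) :
  is_derive t 1 f df ->
  is_derive t 1 (fun s => expR (k * s) * f s) (expR (k * t) * (df + k * f t)).
Proof.
move=> f'; have -> : expR (k * t) * (df + k * f t) =
   expR (k * t) *: df + f t *: (k * expR (k * t)).
  by rewrite /GRing.scale /=; ring.
have de : is_derive t 1 (fun s => expR (k * s)) (k * expR (k * t)).
  have dk : is_derive t 1 (fun s : R => k * s) k.
    rewrite -[X in is_derive _ _ _ X]mulr1.
    exact: (is_deriveZ (f := id) k (is_derive_id t 1)).
  have := is_derive1_comp (is_derive_expR (k * t)) dk.
  by rewrite mulrC.
exact: is_deriveM.
Qed.

Lemma continuous_expRM (R : realType) (k b : R) (f : R -> R) :
  {within `[0, b], continuous f} ->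
  {within `[0, b], continuous (fun s => expR (k * s) * f s)}.
Proof.
move=> cf.
have ce : {within `[0, b], continuous (fun s => expR (k * s))}.
  apply: continuous_subspaceT => x.
  apply: (@continuous_comp _ _ _ (fun s => k * s) expR).
    by apply: cvgM; [exact: cvg_cst|exact: cvg_id].
  exact: continuous_expR.
by move=> x; apply: cvgM; [exact: ce|exact: cf].
Qed.

(** Solutions in the classical sense away from the switching times, coordinate by
    coordinate. All estimates use only this form. *)
Record switched_trajectory (R : realType) (alpha beta gamma delta : R)
    (p q : R -> R) : Prop := SwitchedTrajectory {
  trajectory_cont_fst : forall b, 0 <= b -> {within `[0, b], continuous p};
  trajectory_cont_snd : forall b, 0 <= b -> {within `[0, b], continuous q};
  trajectory_derive_fst : forall n t,
    switch_time R n < t < switch_time R n.+1 ->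
    is_derive t 1 p (- alpha * p t + delta * q t);
  trajectory_derive_snd : forall n t,
    switch_time R n < t < switch_time R n.+1 ->
    is_derive t 1 q (switch_rate beta gamma n * q t) }.

(** On a phase of constant rate c, the function q e^(- c t) has derivative 0. *)
Lemma trajectory_snd_piece (R : realType) (alpha beta gamma delta : R)
    (p q : R -> R) :
  switched_trajectory alpha beta gamma delta p q ->
  forall n t, switch_time R n <= t -> t <= switch_time R n.+1 ->
  q t = q (switch_time R n)
        * expR (switch_rate beta gamma n * (t - switch_time R n)).
Proof.
move=> tr n t; set c := switch_rate beta gamma n; set T := switch_time R n.
move=> Tt tT'; have T0 : 0 <= T by exact: switch_time_ge0.
have cf := continuous_expRM (k := - c)
  (trajectory_cont_snd tr (le_trans T0 Tt)).
have cTt : {within `[T, t], continuous (fun s => expR (- c * s) * q s)}.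
  by apply: continuous_subspaceW cf; apply: subset_itvr; rewrite bnd_simp.
have f' x : x \in `]T, t[%R ->
    is_derive x 1 (fun s => expR (- c * s) * q s) ((fun=> 0) x).
  rewrite in_itv /= => /andP[Tx xt].
  have xn : switch_time R n < x < switch_time R n.+1.
    by rewrite Tx (lt_le_trans xt tT').
  have := is_derive_expRM (- c) (trajectory_derive_snd tr xn).
  by rewrite -/c (mulNr c (q x)) subrr mulr0.
have [x _] := MVT_segment Tt f' cTt; rewrite mul0r => /eqP; rewrite subr_eq0.
move=> /eqP qt; have -> : q t = expR (c * t) * (expR (- c * t) * q t).
  by rewrite mulrA -expRD mulNr subrr expR0 mul1r.
by rewrite qt mulrBr expRD mulNr; ring.
Qed.

(** A decay phase of length d contributes - beta d to the exponent of q, and the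
    next growth phase at most 2 gamma d; when it lasts 2 d, the average rate over
    both is (2 gamma - beta) / 3 = - theta. The bound also holds inside the phases,
    because the exponent is below - theta t at the start of each decay phase. *)
Lemma trajectory_snd_exponent (R : realType) (alpha beta gamma delta theta : R)
    (p q : R -> R) :
  0 < gamma -> 0 < theta -> 3 * theta = beta - 2 * gamma ->
  switched_trajectory alpha beta gamma delta p q ->
  forall t, 0 <= t ->
  exists2 a, - beta * t <= a <= - theta * t & q t = q 0 * expR a.
Proof.
move=> g0 th0 thE tr.
pose good t := exists2 a, - beta * t <= a <= - theta * t & q t = q 0 * expR a.
(* One decay phase followed by one growth phase: the bound at the start of the
   decay phase propagates through both. *)
have cycle m : good (switch_time R m.*2) ->
    forall t, switch_time R m.*2 <= t -> t <= switch_time R m.*2.+2 -> good t.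
  case=> a /andP[ba ath] qT t Tt tT''.
  have gap := switch_time_double_gap R m.
  have Q := trajectory_snd_piece tr.
  move: ba ath qT Tt tT'' gap (switch_timeS R m.*2) (Q m.*2.+1) (Q m.*2).
  rewrite /switch_rate /= odd_double /=.
  set T := switch_time R m.*2; set T' : R := 2 ^+ m.*2.
  set T'' : R := 2 ^+ m.*2.+1.
  move=> ba ath qT Tt tT'' gap TT' Q' QQ.
  have [tT'|T't] := leP t T'.
    exists (a - beta * (t - T)); last by rewrite QQ // qT -mulrA -expRD mulNr.
    have : 0 <= (beta - theta) * (t - T) by rewrite mulr_ge0 //; lra.
    by move=> ?; apply/andP; split; lra.
  exists (a - beta * (T' - T) + gamma * (t - T')).
    have : 0 <= (beta + gamma) * (t - T') by rewrite mulr_ge0 //; lra.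
    move=> ?; apply/andP; split; first by lra.
    (* Time t - T' of growth is at most 2 (T' - T), and the decay accumulated
       over T' - T pays for it: beta - theta = 2 (gamma + theta). *)
    have thg : 0 < theta + gamma by lra.
    have : (theta + gamma) * (t - T') <= (theta + gamma) * (2 * (T' - T)).
      by rewrite ler_pM2l //; lra.
    rewrite -subr_ge0 => le_growth; rewrite -subr_ge0.
    have -> : beta = 3 * theta + 2 * gamma by lra.
    by lra.
  rewrite Q' ?(ltW T't) // QQ // ?(ltW TT') // qT -!mulrA -!expRD mulNr.
  by rewrite addrA.
have all_good m t : 0 <= t -> t <= switch_time R m.*2 -> good t.
  elim: m t => [|m IH] t t0 tm.
    have -> : t = 0 by move: tm => /=; lra.
    by exists 0; [rewrite !mulr0 lexx|rewrite expR0 mulr1].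
  have [tm'|/ltW mt] := leP t (switch_time R m.*2); first exact: IH.
  by apply: (cycle m) => //; apply: IH => //; exact: switch_time_ge0.
move=> t t0; have [n tn] := switch_time_bound t.
apply: (all_good n) => //; apply: le_trans tn _.
have le_time : {homo switch_time R : i j / (i <= j)%N >-> i <= j}.
  by apply: homo_leq => // [x y z|i]; [exact: le_trans|exact/ltW/switch_timeS].
by apply: le_time; rewrite -addnn leq_addr.
Qed.

(** By [trajectory_snd_exponent], q vanishes identically, and then p' = - alpha p. *)
Lemma trajectory_invariant_line (R : realType) (alpha beta gamma delta : R)
    (p q : R -> R) :
  0 < gamma -> 2 * gamma < beta ->
  switched_trajectory alpha beta gamma delta p q -> q 0 = 0 ->
  forall t, 0 <= t -> q t = 0 /\ expR (alpha * t) * p t = p 0.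
Proof.
move=> g0 bg tr q0; have q_eq0 t : 0 <= t -> q t = 0.
  move=> t0.
  have [||a _ ->] := trajectory_snd_exponent (theta := (beta - 2 * gamma) / 3)
    g0 _ _ tr t0; [lra|by field|by rewrite q0 mul0r].
move=> t t0; split; first exact: (q_eq0 t t0).
pose w k s := k * (expR (alpha * s) * p s).
(* A function with derivative 0 is nondecreasing, and so is its opposite. *)
have w_homo k : w k 0 <= w k t.
  apply: (@piecewise_nondecreasing _ (w k) (fun=> 0) _ _ 0 t (lexx 0) t0)
    => [b b0|n s ns].
    move=> x; apply: cvgM; first exact: cvg_cst.
    by apply: continuous_expRM; exact: trajectory_cont_fst tr _ b0.
  split; last exact: lexx.
  have s0 : 0 <= s.
    by case/andP: ns => /ltW ns _; exact: le_trans (switch_time_ge0 R n) ns.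
  have := is_deriveZ k (is_derive_expRM alpha (trajectory_derive_fst tr ns)).
  by rewrite (q_eq0 s s0) mulr0 addr0 mulNr addNr mulr0 scaler0.
have := w_homo 1; have := w_homo (-1).
by rewrite /w mulr0 expR0 => ? ?; lra.
Qed.

(** Backward uniqueness. It makes the logarithm of a ratio of norms meaningful at
    all times. *)
Lemma trajectory_neq0 (R : realType) (alpha beta gamma delta : R)
    (p q : R -> R) :
  0 < gamma -> 2 * gamma < beta ->
  switched_trajectory alpha beta gamma delta p q ->
  forall t, 0 <= t -> p t = 0 -> q t = 0 -> p 0 = 0 /\ q 0 = 0.
Proof.
move=> g0 bg tr t t0 pt qt.
have q0 : q 0 = 0.
  have [||a _] := trajectory_snd_exponent (theta := (beta - 2 * gamma) / 3)
    g0 _ _ tr t0; [lra|by field|rewrite qt => /esym/eqP].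
  by rewrite mulf_eq0 (gt_eqF (expR_gt0 _)) orbF => /eqP.
by have [_ <-] := trajectory_invariant_line g0 bg tr q0 t0; rewrite pt mulr0.
Qed.

(** The core of the proof. The scaled solution w = e^(alpha t) (p, q) satisfies
    w1' = delta w2 and w2' = (c + alpha) w2 with w2 >= 0, where c is the current
    rate. Monotonicity of w1 and of w1 + kappa w2 replaces any study of
    the limit of w. *)
Lemma scaled_trajectory_estimate (R : realType) (alpha beta gamma delta : R)
    (p q : R -> R) :
  0 < alpha -> 0 < gamma -> 0 < delta -> 2 * gamma + 3 * alpha < beta ->
  switched_trajectory alpha beta gamma delta p q -> 0 <= q 0 ->
  exists2 C, 0 < C & forall s t, 0 <= s -> s <= t ->
    expR (alpha * t) * (`|p t| + `|q t|) <=
    C * (expR (alpha * s) * (`|p s| + `|q s|)).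
Proof.
move=> a0 g0 d0 bga tr q0.
move: q0; rewrite le_eqVlt => /predU1P[/esym q0|q0].
  have bg : 2 * gamma < beta by lra.
  have line := trajectory_invariant_line g0 bg tr q0.
  exists 1 => // s t s0 st; have t0 := le_trans s0 st.
  have w_p x : 0 <= x -> expR (alpha * x) * (`|p x| + `|q x|) = `|p 0|.
    move=> x0; have [-> <-] := line x x0.
    by rewrite normr0 addr0 normrM (ger0_norm (expR_ge0 _)).
  by rewrite !w_p // mul1r.
(* theta is the average decay rate of q over one period of the switching. *)
pose theta := (beta - 2 * gamma) / 3.
have thE : 3 * theta = beta - 2 * gamma by rewrite /theta; field.
have th0 : 0 < theta by lra.
have qE := trajectory_snd_exponent g0 th0 thE tr.
pose w1 t := expR (alpha * t) * p t.
pose w2 t := expR (alpha * t) * q t.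
have w_sum t : expR (alpha * t) * (`|p t| + `|q t|) = `|w1 t| + `|w2 t|.
  by rewrite mulrDr !normrM (ger0_norm (expR_ge0 _)).
have w2_lower t : 0 <= t -> q 0 * expR (- (beta - alpha) * t) <= w2 t.
  move=> t0; rewrite /w2; have [a /andP[ba _] ->] := qE t t0.
  rewrite mulrCA -expRD ler_pM2l // ler_expR.
  lra.
have w2_upper t : 0 <= t -> w2 t <= q 0 * expR (- (theta - alpha) * t).
  move=> t0; rewrite /w2; have [a /andP[_ ath] ->] := qE t t0.
  rewrite mulrCA -expRD ler_pM2l // ler_expR.
  lra.
have w2_ge0 t : 0 <= t -> 0 <= w2 t.
  move=> t0; apply: le_trans (w2_lower t t0).
  by rewrite mulr_ge0 ?expR_ge0 // ltW.
have dw1 n t : switch_time R n < t < switch_time R n.+1 ->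
    is_derive t 1 w1 (delta * w2 t).
  move=> nt; have := is_derive_expRM alpha (trajectory_derive_fst tr nt).
  by congr is_derive; rewrite /w2; ring.
have dw2 n t : switch_time R n < t < switch_time R n.+1 ->
    is_derive t 1 w2 ((switch_rate beta gamma n + alpha) * w2 t).
  move=> nt; have := is_derive_expRM alpha (trajectory_derive_snd tr nt).
  by congr is_derive; rewrite /w2; ring.
have cw1 b : 0 <= b -> {within `[0, b], continuous w1}.
  by move=> b0; apply: continuous_expRM; exact: trajectory_cont_fst tr _ b0.
have cw2 b : 0 <= b -> {within `[0, b], continuous w2}.
  by move=> b0; apply: continuous_expRM; exact: trajectory_cont_snd tr _ b0.
have pos n t : switch_time R n < t -> 0 <= t.
  by move=> nt; apply: ltW; apply: le_lt_trans nt; exact: switch_time_ge0.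
have w1_homo s t : 0 <= s -> s <= t -> w1 s <= w1 t.
  apply: (@piecewise_nondecreasing _ w1 (fun x => delta * w2 x)) => // n x nx.
  split; first exact: dw1 nx.
  move: nx => /andP[nx _].
  by rewrite mulr_ge0 ?(ltW d0) // w2_ge0 // (pos n).
(* kappa is the largest factor for which w1 + kappa w2 cannot decrease: w1
   gains at rate delta w2, and w2 loses at most at rate (beta - alpha) w2. *)
pose kappa := delta / (beta - alpha).
have ba0 : 0 < beta - alpha by lra.
have k0 : 0 < kappa by rewrite divr_gt0.
have kE : kappa * (beta - alpha) = delta by rewrite /kappa divfK // gt_eqF.
have v_homo s t : 0 <= s -> s <= t ->
    w1 s + kappa * w2 s <= w1 t + kappa * w2 t.
  apply: (@piecewise_nondecreasing _ (fun x => w1 x + kappa * w2 x)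
           (fun x => 'D_1 (fun x => w1 x + kappa * w2 x) x)) => // [b b0|n x nx].
    move=> x; apply: cvgD; first exact: cw1.
    by apply: cvgM; [exact: cvg_cst|exact: cw2].
  have dv := is_deriveD (dw1 n x nx) (is_deriveZ kappa (dw2 n x nx)).
  have -> : 'D_1 (fun x => w1 x + kappa * w2 x) x =
      delta * w2 x + kappa * ((switch_rate beta gamma n + alpha) * w2 x).
    exact: (@derive_val _ _ _ _ _ _ _ dv).
  split; first exact: dv.
  move: nx => /andP[nx _]; have w2x := w2_ge0 x (pos n x nx).
  rewrite mulrA -mulrDl mulr_ge0 // -kE -mulrDr mulr_ge0 ?(ltW k0) //.
  by rewrite /switch_rate; case: ifP => _; lra.
(* The derivative of w1 is at most delta q(0) e^(- eta t), so subtracting a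
   primitive of that bound from w1 leaves a nonincreasing function. *)
pose eta := theta - alpha.
have eta0 : 0 < eta by rewrite /eta; lra.
have w1_upper t : 0 <= t -> w1 t <= w1 0 + delta / eta * q 0.
  pose u x := expR (- eta * x) * (- (delta / eta * q 0)) + (- w1 x).
  move=> t0; suff : u 0 <= u t.
    rewrite /u mulr0 expR0 mul1r.
    have : 0 <= expR (- eta * t) * (delta / eta * q 0).
      by rewrite mulr_ge0 ?expR_ge0 // ltW // mulr_gt0 // divr_gt0.
    by lra.
  apply: (@piecewise_nondecreasing _ u
    (fun x => expR (- eta * x) * (delta * q 0) - delta * w2 x)
    _ _ 0 t (lexx 0) t0) => [b b0|n x nx].
    move=> x; apply: cvgD; last by apply: cvgN; exact: cw1.
    by apply: (continuous_expRM (f := fun=> _)) => // y; exact: cvg_cst.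
  split; last first.
    move: nx => /andP[nx _]; have := w2_upper x (pos n x nx).
    rewrite -/eta => w2u.
    by rewrite subr_ge0 [leRHS]mulrCA ler_pM2l // mulrC.
  have := is_deriveD
    (is_derive_expRM (- eta) (is_derive_cst (- (delta / eta * q 0)) x 1))
    (is_deriveN (dw1 n x nx)).
  congr is_derive; congr (_ * _ + _).
  by rewrite add0r mulNr mulrN opprK; field; rewrite gt_eqF.
have w2_le t : 0 <= t -> w2 t <= q 0.
  move=> t0; apply: le_trans (w2_upper t t0) _.
  by rewrite ler_piMr ?(ltW q0) // -expR0 ler_expR mulNr oppr_le0 mulr_ge0 // ltW.
have w1_norm t : 0 <= t -> `|w1 t| <= `|w1 0| + delta / eta * q 0.
  move=> t0; have := w1_upper t t0; have := w1_homo 0 t (lexx 0) t0.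
  have : 0 <= delta / eta * q 0 by rewrite ltW // mulr_gt0 // divr_gt0.
  have := ler_norm (w1 0); have := ler_norm (- w1 0); rewrite normrN.
  by move=> *; rewrite ler_norml; lra.
(* If w1 + kappa w2 never gets positive then w2 is dominated by - w1, which
   is nonnegative and nonincreasing: the solution is controlled by its past. *)
have [[s0 s00 vs0]|v_le0] :=
    pselect (exists2 s0, 0 <= s0 & 0 < w1 s0 + kappa * w2 s0); last first.
  have {}v_le0 t : 0 <= t -> w1 t + kappa * w2 t <= 0.
    by move=> t0; rewrite leNgt; apply/negP => vt; apply: v_le0; exists t.
  exists (1 + kappa^-1); first by rewrite addr_gt0 ?invr_gt0.
  move=> s t s0 st; rewrite !w_sum; have t0 := le_trans s0 st.
  have := w1_homo s t s0 st; have w2t := w2_ge0 t t0; have := v_le0 t t0.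
  have kw2 : 0 <= kappa * w2 t by rewrite mulr_ge0 // ltW.
  move=> vt w1st; have w1t : w1 t <= 0 by lra.
  apply: (@le_trans _ _ ((1 + kappa^-1) * - w1 t)).
    rewrite ler0_norm // ger0_norm // mulrDl mul1r lerD2l.
    by rewrite ler_pdivlMl //; lra.
  apply: ler_wpM2l; first by rewrite addr_ge0 ?invr_ge0 ?(ltW k0).
  have := ler_norm (- w1 s); rewrite normrN; have := normr_ge0 (w2 s).
  by lra.
(* Otherwise w1 + kappa w2 stays above a positive number from s0 on. Before s0
   it is w2 that keeps the scaled solution away from 0. *)
pose low := Num.min ((w1 s0 + kappa * w2 s0) / (1 + kappa))
                    (q 0 * expR (- (beta - alpha) * s0)).
have low0 : 0 < low.
  by rewrite lt_min divr_gt0 //= ?addr_gt0 // mulr_gt0 // expR_gt0.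
have w_low s : 0 <= s -> low <= `|w1 s| + `|w2 s|.
  move=> s_ge0; rewrite ge_min; apply/orP.
  have [ss0|/ltW s0s] := leP s s0; [right|left].
    apply: le_trans (_ : w2 s <= _); last first.
      by rewrite (ger0_norm (w2_ge0 s s_ge0)) lerDr.
    apply: le_trans (w2_lower s s_ge0); apply: ler_wpM2l; first exact: ltW.
    by rewrite ler_expR !mulNr lerN2 ler_pM2l.
  rewrite ler_pdivrMr ?addr_gt0 //; apply: le_trans (v_homo s0 s s00 s0s) _.
  rewrite (ger0_norm (w2_ge0 s s_ge0)).
  have := ler_norm (w1 s); have := w2_ge0 s s_ge0.
  have : 0 <= kappa * `|w1 s| by rewrite mulr_ge0 // ltW.
  by lra.
pose high := `|w1 0| + delta / eta * q 0 + q 0.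
have high0 : 0 < high.
  by rewrite ltr_wpDl // addr_ge0 // ltW // mulr_gt0 // divr_gt0.
exists (high / low); first exact: divr_gt0.
move=> s t s_ge0 st; rewrite !w_sum; have t_ge0 := le_trans s_ge0 st.
apply: (@le_trans _ _ high).
  by rewrite lerD ?w1_norm // (ger0_norm (w2_ge0 t t_ge0)) w2_le.
by rewrite mulrAC ler_pdivlMr // ler_pM2l // w_low.
Qed.

(** * Solutions given by the fundamental matrix *)

Lemma fundamental_matrix_primitive (R : realType) (d : nat)
    (A X : R -> 'M[R]_d) (xi : 'cV[R]_d) (i : 'I_d) :
  fundamental_matrix A X ->
  is_primitive (fun t => (X t *m xi) i 0) (fun s => (A s *m (X s *m xi)) i 0).
Proof.
case=> _ AX.
have -> : (fun t => (X t *m xi) i 0) = fun t => \sum_j X t i j * xi j 0.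
  by apply/funext => t; rewrite mxE.
have -> : (fun s => (A s *m (X s *m xi)) i 0) =
    fun s => \sum_j (A s *m X s) i j * xi j 0.
  by apply/funext => s; rewrite mulmxA mxE.
apply: is_primitive_sum => j; apply: is_primitiveZ => t t0.
exact: AX.
Qed.

(** Inside a phase the coefficients are locally constant, so the integrated
    equation can be differentiated there. *)
Lemma fundamental_matrix_trajectory (R : realType)
    (alpha beta gamma delta : R) (X : R -> 'M[R]_2) (xi : 'cV[R]_2) :
  fundamental_matrix (switched_matrix alpha beta gamma delta) X ->
  switched_trajectory alpha beta gamma delta
    (fun t => (X t *m xi) 0 0) (fun t => (X t *m xi) 1 0).
Proof.
move=> AX; have prim i := fundamental_matrix_primitive xi i AX.
have pieces n t : switch_time R n < t < switch_time R n.+1 ->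
    0 < t /\ \forall s \near t,
      switched_matrix alpha beta gamma delta s =
      upper_triangular (- alpha) delta (switch_rate beta gamma n).
  move=> /andP[nt tn]; split; first exact: le_lt_trans (switch_time_ge0 R n) nt.
  near=> s; apply: switched_matrix_piece; apply/andP; split.
    by apply: ltW; near: s; exact: lt_nbhsr.
  by near: s; exact: lt_nbhsl.
have row0 (a b c : R) (x : 'cV[R]_2) :
    (upper_triangular a b c *m x) 0 0 = a * x 0 0 + b * x 1 0.
  by rewrite mxE !big_ord_recl big_ord0 addr0 !mxE /=; congr (_ + _ * x _ _);
    apply/val_inj.
have row1 (a b c : R) (x : 'cV[R]_2) :
    (upper_triangular a b c *m x) 1 0 = c * x 1 0.
  rewrite mxE !big_ord_recl big_ord0 addr0 !mxE /= mul0r add0r.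
  by congr (_ * x _ _); apply/val_inj.
split=> [b|b|n t nt|n t nt].
- exact: is_primitive_continuous (prim 0).
- exact: is_primitive_continuous (prim 1).
- have [t0 near_t] := pieces n t nt.
  apply: (is_primitive_derive_near (prim 0) t0
    (h := fun s => - alpha * (X s *m xi) 0 0 + delta * (X s *m xi) 1 0)).
    by apply: filterS near_t => s ->; rewrite row0.
  apply: cvgD; (apply: cvgM; first exact: cvg_cst).
    exact: is_primitive_continuous_at (prim 0) t0.
  exact: is_primitive_continuous_at (prim 1) t0.
have [t0 near_t] := pieces n t nt.
apply: (is_primitive_derive_near (prim 1) t0
  (h := fun s => switch_rate beta gamma n * (X s *m xi) 1 0)).
  by apply: filterS near_t => s ->; rewrite row1.
apply: cvgM; first exact: cvg_cst.
exact: is_primitive_continuous_at (prim 1) t0.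
Unshelve. all: by end_near. Qed.

Lemma ord2_eq (i : 'I_2) : i = 0 \/ i = 1.
Proof. by case: i => -[|[|//]] h; [left|right]; apply/val_inj. Qed.

(** The estimate on w, rid of the factor e^(alpha t) and transferred from the sum
    of the moduli of the coordinates to the norm N. *)
Lemma fundamental_matrix_decay (R : realType) (alpha beta gamma delta : R)
    (N : 'cV[R]_2 -> R) (X : R -> 'M[R]_2) (xi : 'cV[R]_2) :
  0 < alpha -> 0 < gamma -> 0 < delta -> 2 * gamma + 3 * alpha < beta ->
  is_norm N ->
  fundamental_matrix (switched_matrix alpha beta gamma delta) X ->
  exists2 K, 0 < K & forall s t, 0 <= s -> s <= t ->
    N (X t *m xi) <= K * expR (- alpha * (t - s)) * N (X s *m xi).
Proof.
move=> a0 g0 d0 bga NN AX.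
(* Changing the sign of xi changes neither side of the estimate. *)
wlog xi1 : xi / 0 <= xi 1 0.
  move=> wlog_xi; have [/wlog_xi//|/ltW xi1] := leP 0 (xi 1 0).
  have [|K K0 KX] := wlog_xi (- xi); first by rewrite mxE oppr_ge0.
  exists K => // s t s0 st; have := KX s t s0 st.
  by rewrite !mulmxN !(is_normN NN).
have tr := fundamental_matrix_trajectory xi AX.
have q0 : 0 <= (X 0 *m xi) 1 0 by rewrite AX.1 mul1mx.
have [C C0 est] := scaled_trajectory_estimate a0 g0 d0 bga tr q0.
have [M M0 NM] := is_norm_le NN; have [m m0 Nm] := is_norm_ge NN.
have norm_le (x : 'cV[R]_2) : `|x| <= `|x 0 0| + `|x 1 0|.
  rewrite [leLHS]mx_normrE; apply/bigmax_leP; split; first exact: addr_ge0.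
  move=> -[i j] _ /=; rewrite (ord1 j).
  by have [->|->] := ord2_eq i; rewrite ?lerDl ?lerDr.
have norm_ge (x : 'cV[R]_2) : `|x 0 0| + `|x 1 0| <= 2 * `|x|.
  by rewrite mulr2n mulrDl !mul1r lerD ?ler_coord_norm.
exists (M * C * 2 / m); first by rewrite !mulr_gt0 ?invr_gt0.
move=> s t s0 st.
apply: le_trans (NM _) _.
set e := expR (- alpha * (t - s)).
have e_split : e = (expR (alpha * t))^-1 * expR (alpha * s).
  by rewrite /e -expRN -expRD; congr expR; ring.
have est' : `|(X t *m xi) 0 0| + `|(X t *m xi) 1 0| <=
    C * e * (`|(X s *m xi) 0 0| + `|(X s *m xi) 1 0|).
  have := est s t s0 st; rewrite mulrC -ler_pdivlMr ?expR_gt0 // => h.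
  apply: le_trans h _; rewrite e_split le_eqVlt; apply/orP; left; apply/eqP.
  by ring.
have e0 : 0 < e by exact: expR_gt0.
have -> : M * C * 2 / m * e * N (X s *m xi) =
    M * (C * e * (2 * (N (X s *m xi) / m))) by ring.
rewrite ler_pM2l //; apply: le_trans (norm_le _) _; apply: le_trans est' _.
rewrite ler_pM2l ?mulr_gt0 //; apply: le_trans (norm_ge _) _.
by rewrite ler_pM2l // ler_pdivlMr // mulrC.
Qed.

(** * The Bohl spectrum *)

(** The factor K only contributes ln K / (t - s), which tends to 0. Positivity of
    f is essential, since ln is 0 outside the positive reals. *)
Lemma ln_ratio_limit_le (R : realType) (f : R -> R) (a K : R)
    (t s : nat -> R) (l : \bar R) :
  0 < K -> (forall x, 0 <= x -> 0 < f x) ->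
  (forall x y, 0 <= x -> x <= y -> f y <= K * expR (a * (y - x)) * f x) ->
  (forall n, 0 <= t n) -> (forall n, 0 <= s n) ->
  t n - s n @[n --> \oo] --> +oo ->
  ((t n - s n)^-1 * ln (f (t n) / f (s n)))%:E @[n --> \oo] --> l ->
  (l <= a%:E)%E.
Proof.
move=> K0 f0 f_le t0 s0 ts_oo cvl; apply/lee_addgt0Pr => e e0.
apply: cvge_to_le cvl _.
move/cvgryPge : ts_oo => /(_ (Num.max 1 (ln K / e))) ts_large.
near=> n; rewrite -EFinD lee_fin.
have : Num.max 1 (ln K / e) <= t n - s n by near: n.
rewrite ge_max => /andP[ts1]; rewrite ler_pdivrMr // => lnK.
have ts0 : 0 < t n - s n by lra.
rewrite mulrC ler_pdivrMr //.
apply: (@le_trans _ _ (ln (K * expR (a * (t n - s n))))).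
  rewrite ler_ln ?posrE ?divr_gt0 ?f0 ?mulr_gt0 ?expR_gt0 //.
  by rewrite ler_pdivrMr ?f0 // f_le //; lra.
rewrite lnM ?posrE ?expR_gt0 // expRK.
by lra.
Unshelve. all: by end_near. Qed.

Theorem proposition32 (R : realType) (alpha beta gamma delta : R)
    (alpha_gt0 : 0 < alpha) (beta_gt0 : 0 < beta)
    (gamma_gt0 : 0 < gamma) (delta_gt0 : 0 < delta)
    (beta_gt : 2 * gamma + 3 * alpha < beta)
    (gamma_gt : 2 * alpha < gamma) (delta_ge1 : 1 <= delta)
    (N : 'cV[R]_2 -> R) (N_norm : is_norm N)
    (X : R -> 'M[R]_2)
    (X_fundamental :
      fundamental_matrix (switched_matrix alpha beta gamma delta) X) :
  (forall lambda : \bar R,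
     bohl_spectrum N X lambda -> (lambda <= (- alpha)%:E)%E) /\
  - alpha < 0.
Proof.
split; last by rewrite oppr_lt0.
move=> l [xi /= xi0 [t [s [t0 s0 ts_oo cvl]]]].
have [K K0 decay] := fundamental_matrix_decay xi
  alpha_gt0 gamma_gt0 delta_gt0 beta_gt N_norm X_fundamental.
apply: (ln_ratio_limit_le (f := fun x => N (X x *m xi)) K0 _ decay t0 s0) cvl => //.
move=> x x0; rewrite lt_neqAle is_norm_ge0 // andbT eq_sym.
apply: contra_neq xi0; case: N_norm => _ _ N0 /N0 Xxi.
have tr := fundamental_matrix_trajectory xi X_fundamental.
have bg : 2 * gamma < beta by lra.
have Xi i : (X x *m xi) i 0 = 0 by rewrite Xxi mxE.
have := trajectory_neq0 gamma_gt0 bg tr x0 (Xi 0) (Xi 1).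
rewrite X_fundamental.1 mul1mx => -[xi0 xi1].
by apply/colP => i; rewrite mxE; have [->|->] := ord2_eq i.
Qed.
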